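(* Let $X$ be a fake weighted projective space with weights $(\lambda_0,\lambda_1,\ldots,\lambda_n)$ and associated $n$-simplex $P$. Then $$\mathrm{mult}\,P\leq\frac{|N\cap P^\circ|\,h^{n-1}}{\lambda_1\lambda_2\cdots\lambda_n},\qquad\text{where }h:=\sum_{i=0}^n\lambda_i,$$ and $P^\circ$ denotes the interior of $P$.
   Context: Let $N\cong\mathbb{Z}^n$ be a lattice and $N_\mathbb{R}:=N\otimes_\mathbb{Z}\mathbb{R}$. Let $\rho_0,\ldots,\rho_n\in N$ be primitive lattice points with $N_\mathbb{R}=\sum_{i=0}^n\mathbb{R}_{\geq0}\rho_i$. There are positive integers $\lambda_0,\ldots,\lambda_n$ with $\gcd\{\lambda_0,\ldots,\lambda_n\}=1$ such that $\sum_{i=0}^n\lambda_i\rho_i=0$. The cones $\sigma_i$ generated by $\{\rho_j: j\neq i\}$ generate a complete simplicial fan; the associated projective toric variety $X$ is called a fake weighted projective space with weights $(\lambda_0,\ldots,\lambda_n)$ (indexed consistently with the $\rho_i$), and $P:=\mathrm{conv}\{\rho_0,\ldots,\rho_n\}$ is its associated simplex. The multiplicity is $\mathrm{mult}\,P:=[N:\mathbb{Z}\rho_0+\cdots+\mathbb{Z}\rho_n]$. *)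

(* Defs.v *)
From HB Require Import structures.
From mathcomp Require Import all_boot all_order all_algebra.
Set Implicit Arguments. Unset Strict Implicit. Unset Printing Implicit Defensive.
Import Order.TTheory GRing.Theory Num.Theory.
Local Open Scope ring_scope.

(* The lattice N is Z^n, realised as integer row vectors. *)

Definition primitive (n : nat) (v : 'rV[int]_n) : Prop :=
  forall (k : int) (w : 'rV[int]_n), v = k *: w -> (k = 1) \/ (k = -1).

Definition toR (R : realFieldType) (n : nat) (v : 'rV[int]_n) : 'rV[R]_n :=
  map_mx (fun z : int => z%:~R) v.

Definition positively_spans (R : realFieldType) (n k : nat)
  (rho : 'I_k -> 'rV[int]_n) : Prop :=
  forall x : 'rV[R]_n, exists c : 'I_k -> R,
    (forall i, 0 <= c i) /\ x = \sum_i c i *: toR R (rho i).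

Definition in_conv (R : realFieldType) (n k : nat) (pts : 'I_k -> 'rV[R]_n)
  (x : 'rV[R]_n) : Prop :=
  exists c : 'I_k -> R,
    [/\ (forall i, 0 <= c i), \sum_i c i = 1 & x = \sum_i c i *: pts i].

Definition in_interior (R : realFieldType) (n k : nat) (pts : 'I_k -> 'rV[R]_n)
  (x : 'rV[R]_n) : Prop :=
  exists2 e : R, 0 < e &
    forall y : 'rV[R]_n, (forall j, `|y 0 j - x 0 j| < e) -> in_conv pts y.

Definition in_sublattice (n k : nat) (rho : 'I_k -> 'rV[int]_n)
  (v : 'rV[int]_n) : Prop :=
  exists a : 'I_k -> int, v = \sum_i a i *: rho i.

Definition is_index (n k : nat) (rho : 'I_k -> 'rV[int]_n) (m : nat) : Prop :=
  exists s : seq 'rV[int]_n,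
    [/\ size s = m,
        (forall i j, (i < size s)%N -> (j < size s)%N -> i <> j ->
           ~ in_sublattice rho (nth 0 s i - nth 0 s j)) &
        (forall v, exists2 u, u \in s & in_sublattice rho (v - u))].

Definition enumerates (T : eqType) (P : T -> Prop) (s : seq T) : Prop :=
  uniq s /\ (forall v, v \in s <-> P v).

(* Main.v *)
(** Let L be the lattice spanned by the edges rho_i - rho_0, whose index in N is
    mult P * h: the quotient of Z rho_0 + ... + Z rho_n by L is cyclic of order h,
    generated by rho_0, because the weights are coprime.  In edge coordinates,
    consider the box [0, lam_1/h) x ... x [0, lam_n/h).  If two of its points
    differ by a lattice vector w, and the subtracted one has the larger
    coordinate sum, then adding to w the barycentric coordinates lam_i/h of the
    origin makes all its barycentric coordinates positive: w lies in the interior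
    of P.  A Blichfeldt-type averaging argument yields a translate of N meeting
    the box in at least mult P * h * prod lam_i / h^n points; subtracting the one
    with maximal coordinate sum gives that many interior lattice points.

    The averaging is done on a finite grid: with D the squared determinant of the
    edges and q = h * D, one has q N <= L, so box points, lattice points and their
    sums can be taken with coordinates in (1/q) Z, modulo L. *)

Require Import Defs.
From HB Require Import structures.
From mathcomp Require Import all_boot all_order all_algebra zify ring.
Import Order.TTheory GRing.Theory Num.Theory.
Local Open Scope ring_scope.

(** * Finite counting *)

Lemma pigeonhole_fiber {T T' : finType} (f : T -> T') (k : nat) :
  (forall y, #|[set x | f x == y]| <= k)%N -> (#|T| <= k * #|T'|)%N.
Proof.
move=> hk; rewrite -sum1_card (partition_big f predT) //=.
rewrite mulnC -sum_nat_const; apply: leq_sum => y _.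
by apply: leq_trans (hk y); rewrite sum1dep_card.
Qed.

Lemma card_dffun_ord (I : finType) (F : I -> nat) :
  #|{dffun forall i : I, 'I_(F i)}| = (\prod_i F i)%N.
Proof.
rewrite card_dep_ffun foldrE big_map big_enum /=.
by apply: eq_bigr => i _; rewrite card_ord.
Qed.

(** * Edge coordinates in a simplex *)

Definition edge_mx {S : pzRingType} {n : nat} (p : 'I_n.+1 -> 'rV[S]_n) : 'M[S]_n :=
  \matrix_(i < n) (p (lift ord0 i) - p ord0).

Lemma comb_edge_mx {S : pzRingType} {n : nat} (p : 'I_n.+1 -> 'rV[S]_n)
    (c : 'I_n.+1 -> S) :
  \sum_i c i *: p i =
    (\sum_i c i) *: p ord0 + (\row_i c (lift ord0 i)) *m edge_mx p.
Proof.
rewrite mulmx_sum_row !big_ord_recl scalerDl -addrA; congr (_ + _).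
rewrite scaler_suml -big_split; apply: eq_bigr => i _.
by rewrite rowK mxE scalerBr /= addrC subrK.
Qed.

Lemma map_edge_mx {S S' : pzRingType} (f : {rmorphism S -> S'}) {n : nat}
    (p : 'I_n.+1 -> 'rV[S]_n) :
  edge_mx (fun i => map_mx f (p i)) = map_mx f (edge_mx p).
Proof. by apply/matrixP => i j; rewrite !mxE rmorphB. Qed.

(** A nearby point differs by a vector with small edge coordinates. They perturb the weights [c]
    with total zero, too little to make any of them negative. *)
Lemma in_interior_pos_comb {R : realFieldType} {n : nat}
    (p : 'I_n.+1 -> 'rV[R]_n) (c : 'I_n.+1 -> R) :
  edge_mx p \in unitmx -> (forall i, 0 < c i) -> \sum_i c i = 1 ->
  in_interior p (\sum_i c i *: p i).
Proof.
move=> Eu c0 c1.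
have [m m0 mc] : exists2 m, 0 < m & forall i, m <= c i.
  have [k _ km] := @Order.TotalTheory.arg_minP _ _ _ (ord0 : 'I_n.+1) predT c isT.
  by exists (c k) => // i; exact: km.
(* The entries of [V] bound the edge coordinates, so the radius [m / C] keeps their absolute sum at
   most [m]. *)
pose V := invmx (edge_mx p); pose C := 1 + \sum_i \sum_j `|V j i|.
have C0 : 0 < C.
  by apply: ltr_pwDl => //; apply: sumr_ge0 => i _; apply: sumr_ge0.
exists (m / C); first exact: divr_gt0.
move=> y hy; pose x := \sum_i c i *: p i; pose s := (y - x) *m V.
have hs i : `|s 0 i| <= m / C * \sum_j `|V j i|.
  rewrite mxE mulr_sumr; apply: le_trans (ler_norm_sum _ _ _) _.
  apply: ler_sum => j _; rewrite normrM; apply: ler_wpM2r => //.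
  by rewrite ltW // !mxE hy.
have hS : \sum_i `|s 0 i| <= m.
  apply: (@le_trans _ _ (m / C * \sum_i \sum_j `|V j i|)).
    by rewrite mulr_sumr; apply: ler_sum.
  rewrite mulrAC ler_pdivrMr // ler_wpM2l ?ltW // /C; exact: ltr_pwDl.
pose a i := if unlift ord0 i is Some j then s 0 j else - \sum_j s 0 j.
have a0 : \sum_i a i = 0.
  rewrite big_ord_recl {1}/a unlift_none.
  by under [X in _ + X]eq_bigr do rewrite /a liftK; rewrite addNr.
exists (fun i => c i + a i); split.
- move=> i; rewrite -lerBlDr sub0r; apply: le_trans (mc i); apply: le_trans hS.
  rewrite /a; case: unliftP => [j|] _.
    rewrite (bigD1 j) //=; apply: (@le_trans _ _ `|s 0 j|).
      by rewrite -normrN ler_norm.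
    by rewrite lerDl sumr_ge0.
  by rewrite opprK; apply: ler_sum => j _; exact: ler_norm.
- by rewrite big_split /= c1 a0 addr0.
under eq_bigr do rewrite scalerDl.
rewrite big_split /= [X in _ + X]comb_edge_mx a0 scale0r add0r.
have -> : \row_i a (lift ord0 i) = s.
  by apply/rowP => i; rewrite mxE /a liftK.
by rewrite /s mulmxKV // addrC subrK.
Qed.

(** A vector orthogonal to all edges is, by the relation [l], orthogonal to [p ord0], hence to the
    whole space. *)
Lemma edge_mx_unit {F : fieldType} {n : nat} (p : 'I_n.+1 -> 'rV[F]_n)
    (l : 'I_n.+1 -> F) :
  \sum_i l i *: p i = 0 -> \sum_i l i != 0 ->
  (forall x : 'rV[F]_n, exists c : 'I_n.+1 -> F, x = \sum_i c i *: p i) ->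
  edge_mx p \in unitmx.
Proof.
move=> lp l0 span; rewrite -unitmx_tr unitmxE unitfE; apply/negP => /det0P[u u0 uE].
have Eu : edge_mx p *m u^T = 0 by rewrite -[LHS]trmxK trmx_mul trmxK uE trmx0.
have p0 : p ord0 *m u^T = 0.
  have := congr1 (mulmxr u^T) lp; rewrite comb_edge_mx /= mulmxDl -mulmxA Eu.
  rewrite mulmx0 addr0 mul0mx -scalemxAl => /eqP.
  by rewrite scaler_eq0 (negPf l0) => /eqP.
have xu (x : 'rV[F]_n) : x *m u^T = 0.
  have [c ->] := span x.
  by rewrite comb_edge_mx mulmxDl -mulmxA Eu -scalemxAl p0 mulmx0 scaler0 addr0.
case/eqP: u0; apply/rowP => i; have := xu (delta_mx 0 i).
by rewrite -rowE => /matrixP/(_ 0 0); rewrite !mxE.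
Qed.

(** * Order of a vertex modulo the edge lattice *)

Lemma dvdn_mul_biggcd {I : finType} (F : I -> nat) (h j : nat) :
  \big[gcdn/0%N]_i F i = 1%N -> (forall i, h %| j * F i)%N -> (h %| j)%N.
Proof.
move=> F1 hF; rewrite -[j]muln1 -F1.
rewrite (big_morph (muln j) (id1 := 0%N) (op1 := gcdn)) ?muln0 //.
  by apply/dvdn_biggcdP => i _; exact: hF.
by move=> x y; rewrite muln_gcdr.
Qed.

Lemma mulmx_det_inj {S : idomainType} {n : nat} (A : 'M[S]_n) (r : 'rV[S]_n) :
  \det A != 0 -> r *m A = 0 -> r = 0.
Proof.
move=> A0 rA; have := congr1 (mulmxr (\adj A)) rA.
rewrite /= -mulmxA mul_mx_adj mul0mx mul_mx_scalar => dr.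
apply/rowP => i; have := congr1 (fun m : 'rV[S]_n => m 0 i) dr; rewrite !mxE => /eqP.
by rewrite mulf_eq0 (negPf A0) => /eqP.
Qed.

(** The relation expresses the total weight times [rho ord0] in edges, with coordinates [- lam i].
    As the edges are independent, the total weight divides each [k * lam i]; coprimality
    concludes. *)
Lemma dvdz_mul_vertex {n : nat} (rho : 'I_n.+1 -> 'rV[int]_n)
    (lam : 'I_n.+1 -> nat) (k : int) (z : 'rV[int]_n) :
  \det (edge_mx rho) != 0 ->
  \big[gcdn/0%N]_(i < n.+1) lam i = 1%N ->
  \sum_i (lam i)%:Z *: rho i = 0 ->
  k *: rho ord0 = z *m edge_mx rho ->
  ((\sum_i lam i)%N %| k)%Z.
Proof.
move=> A0 gcd1 rel kz; set h := (\sum_i lam i)%N.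
have hZ : \sum_i (lam i)%:Z = h%:Z.
  by rewrite /h -natz natr_sum; apply: eq_bigr => i _; rewrite natz.
pose l := \row_i (lam (lift ord0 i))%:Z : 'rV[int]_n.
have r0 : h%:Z *: z + k *: l = 0.
  apply: mulmx_det_inj A0 _; rewrite mulmxDl -!scalemxAl -kz scalerA mulrC -scalerA.
  by rewrite -scalerDr -hZ -comb_edge_mx rel scaler0.
have hl i : (h %| k * (lam (lift ord0 i))%:Z)%Z.
  apply/dvdzP; exists (- z 0 i); apply/eqP.
  have := congr1 (fun m : 'rV[int]_n => m 0 i) r0; rewrite !mxE => /eqP.
  by rewrite addrC addr_eq0 mulNr (mulrC (z 0 i)).
(* The vertex [ord0] has no edge coordinate of its own; its term is [k * h] minus the others. *)
have h0 : (h %| k * (lam ord0)%:Z)%Z.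
  have : (h %| k * \sum_i (lam i)%:Z)%Z by rewrite hZ dvdz_mull.
  rewrite big_ord_recl mulrDr rpredDr //.
  by rewrite mulr_sumr rpred_sum.
rewrite dvdzE; apply: (dvdn_mul_biggcd lam) gcd1 _ => i.
have : (h %| k * (lam i)%:Z)%Z by case: (unliftP ord0 i) => [j|] ->.
by rewrite dvdzE abszM.
Qed.

(** Barycentric coordinates of [w] are those of the origin plus a perturbation: the box bound on
    [b'] keeps them positive away from [ord0], the comparison of sums does so at [ord0]. *)
Lemma in_interior_box_diff {R : realFieldType} {n : nat}
    (rho : 'I_n.+1 -> 'rV[int]_n) (lam : 'I_n.+1 -> nat) (D : nat)
    (b b' : 'I_n -> nat) (w : 'rV[int]_n) :
  \det (edge_mx rho) != 0 -> (forall i, 0 < lam i)%N ->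
  \sum_i (lam i)%:Z *: rho i = 0 -> (0 < D)%N ->
  (forall i, b' i < D * lam (lift ord0 i))%N ->
  (\sum_i b i <= \sum_i b' i)%N ->
  (\row_i ((b i)%:Z - (b' i)%:Z)) *m edge_mx rho =
    ((\sum_i lam i) * D)%N%:Z *: w ->
  in_interior (fun i => toR R (rho i)) (toR R w).
Proof.
move=> A0 lam0 rel D0 b'D bb' bw; set h := (\sum_i lam i)%N in bw.
have h0 : (0 < h)%N by rewrite /h big_ord_recl ltn_addr.
have hR0 : (0 : R) < h%:R by rewrite ltr0n.
have DR0 : (0 : R) < D%:R by rewrite ltr0n.
have q0 : (0 : R) < (h * D)%:R by rewrite ltr0n muln_gt0 h0.
have EE : edge_mx (fun i => toR R (rho i)) = map_mx intr (edge_mx rho).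
  exact: map_edge_mx.
pose s (j : 'I_n) : R := ((b j)%:R - (b' j)%:R) / (h * D)%:R.
pose a i := if unlift ord0 i is Some j then s j else - \sum_j s j.
have a0 : \sum_i a i = 0.
  rewrite big_ord_recl {1}/a unlift_none.
  by under [X in _ + X]eq_bigr do rewrite /a liftK; rewrite addNr.
pose c i : R := (lam i)%:R / h%:R + a i.
have -> : toR R w = \sum_i c i *: toR R (rho i).
  under eq_bigr do rewrite scalerDl.
  rewrite big_split /= [X in _ + X]comb_edge_mx a0 scale0r add0r.
  rewrite (eq_bigr (fun i => h%:R^-1 *: toR R ((lam i)%:Z *: rho i))); last first.
    by move=> i _; rewrite /toR map_mxZ scalerA mulrC.
  rewrite -scaler_sumr -[X in _ *: X](map_mx_sum (intr : {rmorphism int -> R})) rel.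
  rewrite map_mx0 scaler0 add0r EE.
  apply: (scalerI (lt0r_neq0 q0)); rewrite scalemxAl.
  have <- : map_mx (intr : int -> R) (\row_i ((b i)%:Z - (b' i)%:Z)) =
     (h * D)%:R *: \row_i a (lift ord0 i).
    apply/rowP => i; rewrite !mxE /a liftK /s mulrC divfK ?gt_eqF //.
    by rewrite rmorphB.
  by rewrite -map_mxM bw map_mxZ.
apply: in_interior_pos_comb.
- by rewrite EE unitmxE det_map_mx unitfE intr_eq0.
- move=> i; rewrite /c /a; case: unliftP => [j|] ->.
    have -> : (lam (lift ord0 j))%:R / h%:R + s j =
        ((D * lam (lift ord0 j))%:R + (b j)%:R - (b' j)%:R) / (h * D)%:R.
      by rewrite /s !natrM; field; rewrite !gt_eqF.
    by rewrite divr_gt0 // subr_gt0 -natrD ltr_nat ltn_addr.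
  rewrite ltr_wpDr ?divr_gt0 ?ltr0n // oppr_ge0 /s -mulr_suml.
  rewrite pmulr_lle0 ?invr_gt0 // sumrB -!natr_sum subr_le0 ler_nat //.
- by rewrite big_split /= a0 addr0 -mulr_suml -natr_sum divff ?gt_eqF.
Qed.

Lemma mulmx_edge_mx {S : pzRingType} {n : nat} (p : 'I_n.+1 -> 'rV[S]_n)
    (k : S) (z : 'rV[S]_n) :
  exists c : 'I_n.+1 -> S, k *: p ord0 + z *m edge_mx p = \sum_i c i *: p i.
Proof.
pose c i := if unlift ord0 i is Some j then z 0 j else k - \sum_j z 0 j.
exists c; rewrite comb_edge_mx.
have -> : \row_i c (lift ord0 i) = z by apply/rowP => i; rewrite mxE /c liftK.
rewrite big_ord_recl {1}/c unlift_none.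
by under [X in _ - _ + X]eq_bigr do rewrite /c liftK; rewrite subrK.
Qed.

(** * Averaging over the grid *)

Theorem mainTheorem7 (R : realFieldType) (n : nat)
  (rho : 'I_n.+1 -> 'rV[int]_n) (lam : 'I_n.+1 -> nat)
  (mult : nat) (interior_pts : seq 'rV[int]_n) :
  (0 < n)%N ->
  (forall i, primitive (rho i)) ->
  positively_spans R rho ->
  (forall i, 0 < lam i)%N ->
  \big[gcdn/0%N]_(i < n.+1) lam i = 1%N ->
  \sum_(i < n.+1) (lam i)%:Z *: rho i = 0 ->
  is_index rho mult ->
  enumerates (fun v => in_interior (fun i => toR R (rho i)) (toR R v))
    interior_pts ->
  (mult * \prod_(i < n) lam (lift ord0 i)
     <= size interior_pts * (\sum_(i < n.+1) lam i) ^ n.-1)%N.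
Proof.
move=> n0 _ span lam0 gcd1 rel [reps [<- reps_inc _]] [_ int_ptsP].
set h := (\sum_(i < n.+1) lam i)%N; set A := edge_mx rho; set d := \det A.
have h0 : (0 < h)%N by rewrite /h big_ord_recl ltn_addr.
have d0 : d != 0.
  have : edge_mx (fun i => toR R (rho i)) \in unitmx.
    apply: (edge_mx_unit _ (fun i => (lam i)%:R)).
    - rewrite (eq_bigr (fun i => toR R ((lam i)%:Z *: rho i))); last first.
        by move=> i _; rewrite /toR map_mxZ.
      by rewrite -(map_mx_sum (intr : {rmorphism int -> R})) rel map_mx0.
    - by rewrite -natr_sum pnatr_eq0 -lt0n.
    by move=> x; have [c [_ cx]] := span x; exists c.
  by rewrite (map_edge_mx intr) unitmxE det_map_mx unitfE intr_eq0.
pose D := (`|d| ^ 2)%N; pose q := (h * D)%N.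
have D0 : (0 < D)%N by rewrite expn_gt0 absz_gt0 d0.
have q0 : (0 < q)%N by rewrite muln_gt0 h0.
have qE : q%:Z = h%:Z * d * d 
  by rewrite /q /D -mulnn !PoszM abszE -normrM -expr2 ger0_norm ?sqr_ge0 // mulrA.
(* The edge coordinates of q v, by Cramer's rule. *)
pose kap (v : 'rV[int]_n) := (h%:Z * d) *: (v *m \adj A).
have kapA v : kap v *m A = q%:Z *: v.
  by rewrite /kap -scalemxAl -mulmxA mul_adj_mx mul_mx_scalar scalerA qE.
have kapz z : kap (z *m A) = q%:Z *: z.
  by rewrite /kap -mulmxA mul_mx_adj mul_mx_scalar scalerA qE.
have kapD u v : kap (u + v) = kap u + kap v by rewrite /kap mulmxDl scalerDr.
have kapB u v : kap (u - v) = kap u - kap v by rewrite /kap mulmxBl scalerBr.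
clearbody kap.
(* Representatives of N / L: those of N / (Z rho_0 + ... + Z rho_n), shifted by
   0, rho_0, ..., (h - 1) rho_0. *)
pose g (x : 'I_(size reps) * 'I_h) := nth 0 reps x.1 + (x.2)%:Z *: rho ord0.
(* Modulo all vertices the representatives must agree; then [h] divides a difference of two numbers
   below [h]. *)
have g_inc x y z : g x - g y = z *m A -> x = y.
  case: x y => [s j] [s' j']; rewrite /g /= => gz.
  have gz' : nth 0 reps s - nth 0 reps s' = (j'%:Z - j%:Z) *: rho ord0 + z *m A.
    by rewrite -gz; apply/rowP => k; rewrite !mxE; ring.
  have ss : s = s'.
    apply/eqP; apply/negPn/negP => ss.
    apply: (reps_inc s s') => //; first by move/val_inj/eqP; rewrite (negPf ss).
    by have [c cE] := mulmx_edge_mx rho (j'%:Z - j%:Z) z; exists c; rewrite gz'.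
  subst s'; congr (_, _); apply/val_inj => /=.
  have : (h %| j%:Z - j'%:Z)%Z.
    apply: (dvdz_mul_vertex rho lam _ z) => //.
    by rewrite -/A -gz; apply/rowP => k; rewrite !mxE; ring.
  rewrite -eqz_mod_dvd => /eqP; rewrite !modz_nat => -[].
  by rewrite !modn_small.
(* In units of 1/q the box side [lam i / h] has length [D * lam i]; [T] pairs its grid points with
   classes of N / L. *)
pose T := ({dffun forall i : 'I_n, 'I_(D * lam (lift ord0 i))} *
           ('I_(size reps) * 'I_h))%type.
pose res (t : T) i : int := (t.1 i)%:Z + kap (g t.2) 0 i.
(* Since [q] is positive, [q.-1.+1] is [q], and [inord] never takes its default value on a
   residue. *)
pose f (t : T) : {ffun 'I_n -> 'I_q.-1.+1} :=
  [ffun i => inord `|(res t i %% q)%Z|%N].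
have f_eq t t' i : f t = f t' -> (q %| res t i - res t' i)%Z.
  move=> /ffunP/(_ i); rewrite !ffunE => /(congr1 val) /=.
  have ltq x : (`|(x %% q)%Z|%N < q.-1.+1)%N.
    by rewrite prednK // -ltz_nat gez0_abs ?modz_ge0 ?ltz_pmod // gt_eqF.
  rewrite !inordK // => /(congr1 Posz); rewrite !gez0_abs ?modz_ge0 ?gt_eqF //.
  by move/eqP; rewrite eqz_mod_dvd.
have : (#|{: T}| <= size interior_pts * #|{ffun 'I_n -> 'I_q.-1.+1}|)%N.
  apply: (pigeonhole_fiber f) => y; set S := [set t | f t == y].
  have [->|[t1 t1S]] := set_0Vmem S; first by rewrite cards0.
  have [t0 t0S tmax] := arg_maxnP (fun t : T => \sum_i t.1 i)%N t1S.
  have fS t : t \in S -> f t = f t0.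
    have : t0 \in S by [].
    by rewrite !inE => /eqP -> /eqP.
  pose z t : 'rV[int]_n := \row_i ((res t i - res t0 i) %/ q)%Z.
  (* The lattice point whose edge coordinates are the box point of [t] minus that of [t0], divided
     by [q]. *)
  pose W t := g t0.2 - g t.2 + z t *m A.
  have kapW t : t \in S -> \row_i ((t.1 i)%:Z - (t0.1 i)%:Z) = kap (W t).
    move=> tS; rewrite /W kapD kapB kapz; apply/rowP => i; rewrite !mxE.
    rewrite mulrC divzK ?f_eq ?fS // /res; ring.
  rewrite cardE -(size_map W); apply: uniq_leq_size.
    (* [W t] determines the box point through [kap], and then the class modulo L through [g_inc]. *)
    rewrite map_inj_in_uniq ?enum_uniq // => t t'; rewrite !mem_enum => tS t'S WE.
    have b_eq : t.1 = t'.1.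
      apply/ffunP => i; apply/val_inj; apply/eqP; rewrite -eqz_nat -subr_eq0.
      have : kap (W t) = kap (W t') by rewrite WE.
      rewrite -!kapW // => /rowP/(_ i); rewrite !mxE => /addIr ->.
      by rewrite subrr.
    rewrite [t]surjective_pairing [t']surjective_pairing b_eq; congr (_, _).
    apply: (g_inc _ _ (z t - z t')).
    move: WE; rewrite /W mulmxBl.
    move: (g t0.2) (g t.2) (g t'.2) (z t *m A) (z t' *m A) => u v v' x x' /rowP WE.
    apply/rowP => i; have := WE i; rewrite !mxE.
    by move: (u 0 i) (v 0 i) (v' 0 i) (x 0 i) (x' 0 i) => *; lia.
  move=> w /mapP[t]; rewrite mem_enum => tS ->; apply/int_ptsP.
  apply: (in_interior_box_diff rho lam D (fun i => t.1 i) (fun i => t0.1 i)) => //.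
  - exact: tmax.
  - by rewrite kapW // kapA.
rewrite card_prod card_dffun_ord card_prod !card_ord card_ffun !card_ord prednK //.
rewrite big_split /= prod_nat_const card_ord /q expnMn => le_card.
(* The h shifts of each representative cancel one of the n factors [h], leaving the exponent
   [n.-1]. *)
have hn : (h ^ n = h * h ^ n.-1)%N by rewrite -expnS prednK.
have Dh0 : (0 < D ^ n * h)%N by rewrite muln_gt0 h0 andbT expn_gt0 D0.
rewrite -(leq_pmul2l Dh0).
have -> (a b : nat) : (D ^ n * h * (a * b) = D ^ n * b * (a * h))%N by ring.
have -> : (D ^ n * h * (size interior_pts * h ^ n.-1) =
    size interior_pts * (h ^ n * D ^ n))%N by rewrite hn; ring.
exact: le_card.
Qed.
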